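(* (a) For every real $\alpha<0$: $\mu_{1,m}(\alpha)$ is strictly increasing in $m\ge2$; $\mu_{5,m}(\alpha)$ is strictly increasing in $m\ge3$; and for every $m\ge2$, \[ \mu_{1,m}(\alpha)<\mu_2(\alpha)<\mu_3(\alpha)<\mu_4(\alpha)<\mu_{5,3}(\alpha). \] (b) For every real $\alpha\in(0,\tfrac12)$, all the inequalities and monotonicities in (a) hold with the order reversed (i.e. $\mu_{1,m}(\alpha)$ and $\mu_{5,m}(\alpha)$ are strictly decreasing in $m$ and $\mu_{1,m}(\alpha)>\mu_2(\alpha)>\mu_3(\alpha)>\mu_4(\alpha)>\mu_{5,3}(\alpha)$), and the same reversed statements hold with $\mu(\alpha)$ replaced by $\mu'$.
   Context: Consider Galton–Watson trees with offspring distributions: $\xi_{1,m}\sim\mathrm{Bin}(m,1/m)$ ($m\ge2$); $\xi_2\sim\mathrm{Po}(1)$; $\xi_3\sim 2\,\mathrm{Bin}(1,1/2)$; $\xi_4\sim\mathrm{Ge}(1/2)$, i.e. $\mathbb P(\xi_4=k)=2^{-k-1}$, $k\ge0$; $\xi_{5,m}\sim m\,\mathrm{Bin}(1,1/m)$ ($m\ge3$). For a Galton–Watson tree $\mathcal T$ with the indicated offspring distribution (indexed by the same subscript), $\mu(\alpha):=\mathbb E|\mathcal T|^\alpha$ for real $\alpha<1/2$ and $\mu':=\mathbb E\log|\mathcal T|$, where $|\mathcal T|$ is the number of vertices. *)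

(* Defs.v *)
From HB Require Import structures.
From mathcomp Require Import all_boot all_order all_algebra.
From mathcomp Require Import all_classical all_reals all_analysis.
Set Implicit Arguments. Unset Strict Implicit. Unset Printing Implicit Defensive.
Import Order.TTheory GRing.Theory Num.Theory.
Local Open Scope ring_scope.

Inductive ptree : Type := PNode of seq ptree.

Fixpoint ptree_enc (t : ptree) : GenTree.tree unit :=
  let: PNode l := t in GenTree.Node 0 (map ptree_enc l).

Fixpoint ptree_dec (g : GenTree.tree unit) : ptree :=
  match g with
  | GenTree.Leaf _ => PNode [::]
  | GenTree.Node _ l => PNode (map ptree_dec l)
  end.

Fixpoint ptree_encK (t : ptree) : ptree_dec (ptree_enc t) = t :=
  match t return ptree_dec (ptree_enc t) = t with
  | PNode l => f_equal PNode
      ((fix aux (l : seq ptree) : map ptree_dec (map ptree_enc l) = l :=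
          match l return map ptree_dec (map ptree_enc l) = l with
          | [::] => erefl
          | a :: l' => f_equal2 cons (ptree_encK a) (aux l')
          end) l)
  end.

HB.instance Definition _ := Equality.copy ptree (can_type ptree_encK).
HB.instance Definition _ := Choice.copy ptree (can_type ptree_encK).
HB.instance Definition _ := Countable.copy ptree (can_type ptree_encK).

Fixpoint tsize (t : ptree) : nat :=
  let: PNode l := t in (sumn (map tsize l)).+1.

(** Galton--Watson weight of a plane tree for offspring pmf p:
    P(T = t) = prod_{v in t} p(number of children of v). *)
Fixpoint gw_weight {R : realType} (p : nat -> R) (t : ptree) : R :=
  let: PNode l := t in p (size l) * \prod_(c <- map (gw_weight p) l) c.

(** mu(alpha) = E |T|^alpha for the GW tree T with offspring pmf p
    (sum over all finite plane trees; valued in the extended reals). *)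
Definition gw_mu {R : realType} (p : nat -> R) (alpha : R) : \bar R :=
  \esum_(t in [set: ptree]) (((tsize t)%:R `^ alpha) * gw_weight p t)%:E.

Definition gw_mu' {R : realType} (p : nat -> R) : \bar R :=
  \esum_(t in [set: ptree]) ((ln (tsize t)%:R) * gw_weight p t)%:E.

Definition pmf1 (R : realType) (m : nat) (k : nat) : R :=
  'C(m, k)%:R * (m%:R^-1) ^+ k * (1 - m%:R^-1) ^+ (m - k).
Definition pmf2 (R : realType) (k : nat) : R := expR (-1) / (k`!)%:R.
Definition pmf3 (R : realType) (k : nat) : R :=
  if (k == 0)%N || (k == 2)%N then 2^-1 else 0.
Definition pmf4 (R : realType) (k : nat) : R := (2^-1) ^+ k.+1.
Definition pmf5 (R : realType) (m : nat) (k : nat) : R :=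
  if (k == 0)%N then 1 - m%:R^-1 else if (k == m)%N then m%:R^-1 else 0.

(* Main.v *)
(** Let [g z] be the generating function of the total progeny and [Phi] the one
of the offspring law.  Splitting a tree at its root gives [g = z * Phi g], and
[s |-> s - z * Phi s] is increasing on [0, 1] since [Phi' <= 1]; hence
[Phi1 < Phi2] on (0, 1) implies [g1 < g2] on (0, 1).  The offspring generating
functions are ordered this way along the chain of the theorem.

With [f n = (n ^ alpha - 1) / alpha] ([ln n] when [alpha = 0]) and
[z = exp (- exp u)], for a constant [C >= 0] depending only on [alpha],
<<  \int_R (z - z ^ n) * exp (- alpha * u) du = C * f n  >>
so summing over trees turns [C * E f(|T|)] into the integral of
[(z - g z) * exp (- alpha * u)], which reverses the order of the [g]'s.  The
integral is finite for [alpha < 1/2]: every [Phi] considered satisfies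
[Phi s >= ((1 + s) / 2) ^ 2], which forces [1 - g z = O (sqrt (1 - z))].  Since
the tree is almost surely finite, [E |T| ^ alpha = 1 + alpha * E f(|T|)]. *)

Require Import Defs.
From HB Require Import structures.
From mathcomp Require Import all_boot all_order all_algebra finmap.
From mathcomp Require Import all_classical all_reals all_analysis measurable_realfun.
From mathcomp Require Import ring lra.
Set Implicit Arguments.
Unset Strict Implicit.
Import Order.TTheory GRing.Theory Num.Theory.
Import numFieldNormedType.Exports.
Local Open Scope ring_scope.
Local Open Scope ereal_scope.

(** * Sums over plane trees *)

(** Finite subsums give only one inequality; the other one is the same inequality applied to the
    scalar [c^-1] and the family [c%:E * a i]. *)
Lemma esumZl (R : realType) (T : choiceType) (I : set T) (a : T -> \bar R)
    (c : R) : (0 <= c)%R -> (forall i, I i -> 0 <= a i) ->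
  \esum_(i in I) (c%:E * a i) = c%:E * \esum_(i in I) a i.
Proof.
move=> c0 a0.
have le (b : T -> \bar R) (d : R) : (0 <= d)%R -> (forall i, I i -> 0 <= b i) ->
    \esum_(i in I) (d%:E * b i) <= d%:E * \esum_(i in I) b i.
  move=> d0 b0; apply: ge_ereal_sup => _ [X [finX XI]] <-.
  rewrite fsbig_finite//= big_seq -ge0_sume_distrr; last first.
    by move=> i; rewrite in_fset_set// inE => /XI/b0.
  rewrite -big_seq -fsbig_finite//=; apply: lee_wpmul2l; first by rewrite lee_fin.
  by apply: ereal_sup_ubound; exists X.
apply/eqP; rewrite eq_le le//=.
have [->|cneq0] := eqVneq c 0%R.
  by rewrite mul0e; apply: esum_ge0 => i Ii; rewrite mul0e.
have cgt0 : (0 < c)%R by rewrite lt_neqAle eq_sym cneq0.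
have -> : \esum_(i in I) a i = \esum_(i in I) (c^-1%:E * (c%:E * a i)).
  by apply: eq_esum => i _; rewrite muleA -EFinM mulVf// mul1e.
rewrite -[leRHS]mul1e -(divff cneq0) EFinM -muleA.
apply: lee_wpmul2l; first by rewrite lee_fin.
by apply: le; rewrite ?invr_ge0// => i Ii; rewrite mule_ge0 ?lee_fin ?a0.
Qed.

(** Distributivity, by induction on the length: a list of length [k.+1] is a head and a tail. The
    lists stand for the [k] subtrees hanging from the root. *)
Lemma esum_prod_seq (R : realType) (T : choiceType) (A : set T) (a : T -> R)
    (s : R) (k : nat) : (forall c, 0 <= a c)%R ->
  \esum_(c in A) (a c)%:E = s%:E ->
  \esum_(l in [set l : seq T | size l = k /\ forall c, c \in l -> A c]%classic)
     (\prod_(c <- l) a c)%:E = (s ^+ k)%:E.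
Proof.
move=> a0 As; elim: k => [|k IH].
  rewrite (_ : [set l | _] = [set [::] : seq T])%classic; last first.
    by apply/seteqP; split => [[|x l] []//|_ ->].
  by rewrite esum_set1 big_nil// lee_fin.
set L := [set l | size l = k /\ _]%classic in IH.
have P0 (l : seq T) : (0 <= \prod_(c <- l) a c)%R by apply: prodr_ge0.
transitivity (\esum_(c in A) \esum_(l in L) (a c * \prod_(d <- l) a d)%:E).
  rewrite esum_esum; last by move=> *; rewrite lee_fin mulr_ge0.
  rewrite (reindex_esum (A `*`` fun=> L)%classic _ (fun cl => cl.1 :: cl.2)).
    by apply: eq_esum => -[c l] _; rewrite /= big_cons.
  split => [[c l] [/= Ac [<- Al]]|[c l] [d m] _ _ [-> ->]//|[|c l] [//= [sl] Al]].
  - by split=> // d; rewrite inE => /predU1P[->//|/Al].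
  - exists (c, l) => //; split => /=; first by apply: Al; rewrite mem_head.
    by split => // d dl; apply: Al; rewrite inE dl orbT.
transitivity (\esum_(c in A) ((s ^+ k)%:E * (a c)%:E)).
  by apply: eq_esum => c _; rewrite -IH muleC -esumZl// => l _; rewrite lee_fin.
have sk0 : (0 <= s ^+ k)%R by rewrite -lee_fin -IH; apply: esum_ge0 => l _; rewrite lee_fin.
rewrite esumZl// => [|c _]; last by rewrite lee_fin.
by rewrite As -EFinM exprSr.
Qed.

(** The children are nested inside a list, so the generated induction principle carries no
    hypothesis on them; strong induction on the size supplies it. *)
Lemma ptree_rect_seq (P : ptree -> Prop) :
  (forall l : seq ptree, (forall c, c \in l -> P c) -> P (PNode l)) -> forall t, P t.
Proof.
move=> IH t; have [n] := ubnP (Defs.tsize t); elim: n t => // n IHn [l] /=.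
rewrite ltnS => ln; apply: IH => c cl; apply: IHn; apply: leq_trans ln.
elim: l cl => //= d l IHl; rewrite inE => /predU1P[->|/IHl]; last first.
  by move=> /leq_trans; apply; rewrite ltnS leq_addl.
by rewrite ltnS leq_addr.
Qed.

Lemma tsize_gt0 t : (0 < Defs.tsize t)%N. Proof. by case: t. Qed.

Section generating_function.
Context {R : realType}.
Variable p : nat -> R.
Hypothesis p_ge0 : forall k, (0 <= p k)%R.

Lemma gw_weight_ge0 t : (0 <= gw_weight p t)%R.
Proof.
elim/ptree_rect_seq: t => l IH /=; apply: mulr_ge0 => //.
by rewrite big_map big_seq; apply: prodr_ge0.
Qed.

Definition gw_term (z : R) (t : ptree) : R := (z ^+ Defs.tsize t * gw_weight p t)%R.

Lemma gw_term_ge0 (z : R) t : (0 <= z)%R -> (0 <= gw_term z t)%R.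
Proof. by move=> z0; rewrite mulr_ge0 ?exprn_ge0 ?gw_weight_ge0. Qed.

Lemma gw_termE (z : R) l :
  gw_term z (PNode l) = (z * p (size l) * \prod_(c <- l) gw_term z c)%R.
Proof.
rewrite /gw_term /= big_map exprS big_split/= mulrACA; congr (_ * (_ * _))%R.
by elim: l => [|c l IH] /=; rewrite ?big_nil// big_cons exprD IH.
Qed.

(** Splitting at the root, with the lists of children sorted by length. For [A] the set of all trees
    this is the fixed-point equation; for [A] the trees of size at most [n] it controls the trees of
    size at most [n.+1]. *)
Lemma esum_gw_term_rec (z s S : R) (A : set ptree) : (0 <= z)%R ->
  \esum_(t in A) (gw_term z t)%:E = s%:E ->
  \sum_(k <oo) (p k * s ^+ k)%:E = S%:E ->
  \esum_(t in [set PNode l | l in [set l : seq ptree | forall c, c \in l -> A c]]%classic)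
    (gw_term z t)%:E = (z * S)%:E.
Proof.
move=> z0 As pS.
have s0 : (0 <= s)%R.
  by rewrite -lee_fin -As; apply: esum_ge0 => t _; rewrite lee_fin gw_term_ge0.
rewrite esum_image => [|l m _ _ []//].
rewrite (_ : [set l | _] = \bigcup_(k in setT)
    [set l : seq ptree | size l = k /\ forall c, c \in l -> A c])%classic.
  rewrite esum_bigcupT.
  - rewrite EFinM -pS nneseries_esumT => [|k]; last first.
      by rewrite lee_fin mulr_ge0 ?exprn_ge0.
    rewrite -esumZl// => [|k _]; last by rewrite lee_fin mulr_ge0 ?exprn_ge0.
    apply: eq_esum => k _.
    rewrite -EFinM mulrA EFinM -(esum_prod_seq k _ As) => [|c]; last first.
      exact: gw_term_ge0.
    rewrite -esumZl ?mulr_ge0// => [|l _]; last first.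
      by rewrite lee_fin prodr_ge0// => c _; exact: gw_term_ge0.
    by apply: eq_esum => l [<- _]; rewrite gw_termE.
  - by move=> i j _ _ [l [[<- _] [<- _]]].
  - by move=> l; rewrite lee_fin gw_term_ge0.
apply/seteqP; split=> [l Al|l [k _ [_ Al]]] //=.
by exists (size l).
Qed.

End generating_function.

Local Open Scope ring_scope.

(** * The generating function of the total progeny *)

Lemma esum_subset (R : realType) (T : choiceType) (A B : set T)
    (a : T -> \bar R) : (A `<=` B)%classic ->
  (\esum_(i in A) a i <= \esum_(i in B) a i)%E.
Proof.
move=> AB; apply: ge_ereal_sup => _ [X [finX XA] <-].
by apply: ereal_sup_ubound; exists X => //; split => // x /XA/AB.
Qed.

Section critical_pgf.
Context {R : realType}.

(** [cpgf_contraction] is a derivative-free form of [Phi' <= 1]. In [cpgf_ge], the lower bound is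
    the generating function of Bin(2, 1/2), the first law of the chain. *)
Record critical_pgf (p : nat -> R) (Phi : R -> R) : Prop := CriticalPgf {
  cpgf_ge0 : forall k, 0 <= p k ;
  cpgf_series : forall s : R, 0 <= s <= 1 ->
    (\sum_(k <oo) (p k * s ^+ k)%:E = (Phi s)%:E)%E ;
  cpgf1 : Phi 1 = 1 ;
  cpgf_contraction : forall s t : R, 0 <= t -> t <= s -> s <= 1 ->
    Phi s - Phi t <= s - t ;
  cpgf_ge : forall s : R, 0 <= s <= 1 -> ((1 + s) / 2) ^+ 2 <= Phi s }.

Variables (p : nat -> R) (Phi : R -> R).
Hypothesis H : critical_pgf p Phi.

Let p0 := cpgf_ge0 H.

Lemma cpgf_le1 s : 0 <= s <= 1 -> Phi s <= 1.
Proof.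
move=> s01; have /andP[s0 s1] := s01; rewrite -(cpgf1 H) -lee_fin.
rewrite -(cpgf_series H)// -(cpgf_series H) ?lexx ?ler01//.
apply: lee_nneseries => k _.
  by rewrite lee_fin mulr_ge0 ?exprn_ge0.
by rewrite lee_fin ler_wpM2l// expr1n exprn_ile1.
Qed.

(** A tree of size at most [n.+1] has children of size at most [n], so the partial sums satisfy
    [S_(n+1) <= z * Phi S_n <= 1]. This a priori bound makes the full sum finite, before the
    fixed-point equation can be written in the reals. *)
Lemma esum_gw_term_size_le1 (z : R) n : 0 <= z <= 1 ->
  (\esum_(t in [set t | (Defs.tsize t <= n)%N]%classic) (gw_term p z t)%:E <= 1)%E.
Proof.
move=> /andP[z0 z1]; elim: n => [|n IH].
  by rewrite esum1// => -[l].
set S := esum _ _ in IH.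
have S0 : (0 <= S)%E by apply: esum_ge0 => t _; rewrite lee_fin gw_term_ge0.
have Sfin : S \is a fin_num by rewrite ge0_fin_numE// (le_lt_trans IH)// ltry.
have SE : S = (fine S)%:E by rewrite fineK.
have s01 : 0 <= fine S <= 1 by rewrite fine_ge0//= -lee_fin -SE.
apply: (@le_trans _ _ (z * Phi (fine S))%:E); last first.
  by rewrite lee_fin mulr_ile1// ?cpgf_le1// (le_trans _ (cpgf_ge H s01))// sqr_ge0.
rewrite -(esum_gw_term_rec p0 z0 SE (cpgf_series H s01)).
apply: esum_subset => -[l] /=; rewrite ltnS => ln; exists l => //= c cl.
apply: leq_trans ln.
elim: l cl => //= d l IHl; rewrite inE => /predU1P[->|/IHl]; first exact: leq_addr.
by move=> /leq_trans; apply; exact: leq_addl.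
Qed.

Lemma esum_gw_term_le1 (z : R) : 0 <= z <= 1 ->
  (\esum_(t in [set: ptree]) (gw_term p z t)%:E <= 1)%E.
Proof.
move=> z01; apply: ge_ereal_sup => _ [X [finX _] <-].
set n := (\max_(t <- fset_set X) Defs.tsize t)%N.
apply: le_trans (esum_gw_term_size_le1 n z01).
apply: ereal_sup_ubound; exists X => //; split=> // t Xt /=.
apply: leq_bigmax_seq => //; rewrite in_fset_set//. exact: mem_set.
Qed.

Definition gw_pgf z := fine (\esum_(t in [set: ptree]) (gw_term p z t)%:E).

Section gw_pgf.
Variable z : R.
Hypothesis z01 : 0 <= z <= 1.
Let z0 : 0 <= z. Proof. by case/andP: z01. Qed.
Let z1 : z <= 1. Proof. by case/andP: z01. Qed.

Lemma esum_gw_term : (\esum_(t in [set: ptree]) (gw_term p z t)%:E = (gw_pgf z)%:E)%E.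
Proof.
rewrite fineK// ge0_fin_numE; last first.
  by apply: esum_ge0 => t _; rewrite lee_fin gw_term_ge0.
by rewrite (le_lt_trans (esum_gw_term_le1 z01))// ltry.
Qed.

Lemma gw_pgf_01 : 0 <= gw_pgf z <= 1.
Proof.
rewrite -!lee_fin -esum_gw_term esum_gw_term_le1// andbT.
by apply: esum_ge0 => t _; rewrite lee_fin gw_term_ge0.
Qed.

Lemma gw_pgf_fixpoint : gw_pgf z = z * Phi (gw_pgf z).
Proof.
apply: EFin_inj; rewrite -esum_gw_term.
rewrite -(esum_gw_term_rec p0 z0 esum_gw_term (cpgf_series H gw_pgf_01)).
by congr esum; apply/seteqP; split=> [[l] _|//]; exists l.
Qed.

Lemma gw_pgf_le : gw_pgf z <= z.
Proof. by rewrite gw_pgf_fixpoint ler_piMr// cpgf_le1// gw_pgf_01. Qed.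

Lemma gw_pgf_gt0 : 0 < z -> 0 < gw_pgf z.
Proof.
move=> zgt0; rewrite gw_pgf_fixpoint mulr_gt0//.
have /andP[g0 _] := gw_pgf_01.
apply: lt_le_trans (cpgf_ge H gw_pgf_01).
by rewrite exprn_gt0// divr_gt0// ltr_wpDr.
Qed.

(** From [g = z * Phi g] and [cpgf_ge], [z * (1 + g) ^ 2 <= 4 * g]. Subtracting [4 * z * g] leaves
    [z * (1 - g) ^ 2 <= 4 * (1 - z) * g], and [g <= 1]. *)
Lemma gw_pgf_quad : z * (1 - gw_pgf z) ^+ 2 <= 4 * (1 - z).
Proof.
have /andP[g0 g1] := gw_pgf_01.
have h : z * ((1 + gw_pgf z) / 2) ^+ 2 <= gw_pgf z.
  by rewrite {2}gw_pgf_fixpoint ler_wpM2l// (cpgf_ge H)// gw_pgf_01.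
have : (1 - z) * gw_pgf z <= 1 - z by rewrite ler_piMr// subr_ge0.
by lra.
Qed.

End gw_pgf.

(** Almost sure extinction: at [z = 1] the quadratic bound reads [(1 - g) ^ 2 <= 0]. *)
Lemma gw_pgf1 : gw_pgf 1 = 1.
Proof.
have h1 : 0 <= (1 : R) <= 1 by rewrite ler01 lexx.
have := gw_pgf_quad h1; rewrite mul1r subrr mulr0.
by rewrite real_exprn_even_le0//= subr_eq0 => /eqP.
Qed.

End critical_pgf.

(** Write [a], [b] for the two values and suppose [b <= a]. Then [a - b = z * (Phi1 a - Phi2 b) < z
    * (Phi2 a - Phi2 b) <= z * (a - b) <= a - b], a contradiction. The strict step requires
    [0 < a < 1]. *)
Lemma gw_pgf_lt (R : realType) (p1 p2 : nat -> R) (Phi1 Phi2 : R -> R) (z : R) :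
  critical_pgf p1 Phi1 -> critical_pgf p2 Phi2 ->
  (forall s : R, 0 < s < 1 -> Phi1 s < Phi2 s) -> 0 < z < 1 ->
  gw_pgf p1 z < gw_pgf p2 z.
Proof.
move=> H1 H2 lt12 /andP[z0 z1].
have z01 : 0 <= z <= 1 by rewrite !ltW.
have /andP[a0 a1] := gw_pgf_01 H1 z01; have /andP[b0 b1] := gw_pgf_01 H2 z01.
rewrite ltNge; apply/negP => le21.
have := cpgf_contraction H2 b0 le21 a1.
have ag0 := gw_pgf_gt0 H1 z01 z0.
have az := gw_pgf_le H1 z01.
have /lt12 : 0 < gw_pgf p1 z < 1 by rewrite ag0 (le_lt_trans az).
have := gw_pgf_fixpoint H1 z01; have := gw_pgf_fixpoint H2 z01.
move: (gw_pgf p1 z) (gw_pgf p2 z) le21 => a b; move: (Phi1 a) (Phi2 a) (Phi2 b).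
move=> x y w ba bE aE xy yw.
have : z * x < z * y by rewrite ltr_pM2l.
have : z * (y - w) <= z * (a - b) by rewrite ler_pM2l.
have : z * (a - b) <= a - b by rewrite ler_piMl// ?subr_ge0// ltW.
by lra.
Qed.

(** * Integral representation of powers and logarithms *)

(** Sums over trees become series over their codes, where monotone convergence is available; a
    number that codes no element contributes 0. *)
Lemma esum_countType (R : realType) (T : countType) (a : T -> \bar R) :
  (forall t, 0 <= a t)%E ->
  (\esum_(t in [set: T]) a t = \sum_(n <oo) oapp a 0 (pickle_inv n))%E.
Proof.
move=> a0; rewrite nneseries_esumT => [|n]; last by case: pickle_inv => /=.
transitivity (\esum_(n in range (@choice.pickle T)) oapp a 0 (pickle_inv n))%E.
  rewrite esum_image => [|x y _ _ /(congr1 (@pickle_inv T))]; last first.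
    by rewrite !pickleK_inv => -[].
  by apply: eq_esum => t _; rewrite pickleK_inv.
rewrite esum_mkcond; apply: eq_esum => n _; case: ifPn => //.
rewrite notin_setE => nT; case E : (pickle_inv n) => [t|]//=.
by exfalso; apply: nT; exists t => //; move: (pickle_invK (T := T) n); rewrite E.
Qed.

Lemma integral_esum (R : realType) (d : measure_display)
    (X : measurableType d) (mu : {measure set X -> \bar R}) (T : countType)
    (h : T -> X -> \bar R) :
  (forall t, measurable_fun setT (h t)) -> (forall t x, 0 <= h t x)%E ->
  (\int[mu]_x (\esum_(t in [set: T]) h t x) =
   \esum_(t in [set: T]) \int[mu]_x h t x)%E.
Proof.
move=> mh h0; rewrite esum_countType => [|t]; last exact: integral_ge0.
under eq_integral do rewrite esum_countType//.
pose h' n x := oapp (h^~ x) 0%E (pickle_inv n).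
rewrite (@integral_nneseries _ _ _ mu _ measurableT h') //.
- apply: eq_eseriesr => n _; rewrite /h'; case: pickle_inv => //=.
  exact: integral0.
- by move=> n; rewrite /h'; case: pickle_inv => /= [t|]; [exact: mh|exact: measurable_cst].
- by move=> n x _; rewrite /h'; case: pickle_inv => /=.
Qed.

Lemma measurable_esum (R : realType) (d : measure_display)
    (X : measurableType d) (T : countType) (h : T -> X -> \bar R) :
  (forall t, measurable_fun setT (h t)) -> (forall t x, 0 <= h t x)%E ->
  measurable_fun setT (fun x => \esum_(t in [set: T]) h t x)%E.
Proof.
move=> mh h0; pose h' n x := oapp (h^~ x) 0%E (pickle_inv n).
rewrite (_ : (fun x => _) = fun x => (\sum_(n <oo) h' n x)%E); last first.
  by apply/funext => x; rewrite esum_countType.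
apply: ge0_emeasurable_sum.
- by move=> n x _ _; rewrite /h'; case: pickle_inv => /=.
- by move=> n _; rewrite /h'; case: pickle_inv => /= [t|]; [exact: mh|exact: measurable_cst].
Qed.

Lemma FTC2_derivable (R : realType) (f F : R -> R) (a b : R) : a <= b ->
  continuous f -> (forall x : R, is_derive x 1 F (f x)) ->
  (\int[lebesgue_measure]_(x in `[a, b]) (f x)%:E = (F b - F a)%:E)%E.
Proof.
rewrite le_eqVlt => /predU1P[<-|ab] cf dF.
  by rewrite subrr set_itv1 integral_set1.
have cF : continuous F.
  by move=> x; apply/differentiable_continuous/derivable1_diffP; case: (dF x).
rewrite (continuous_FTC2 (F := F))//.
- exact: continuous_subspaceT.
- split=> [x _||]; first by case: (dF x).
  + exact/cvg_at_right_filter/cF.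
  + exact/cvg_at_left_filter/cF.
- by move=> x _; rewrite derive1E; case: (dF x).
Qed.

Lemma ge0_integral_translation (R : realType) (f : R -> R) (s : R) :
  continuous f -> (forall x, 0 <= f x) ->
  (\int[lebesgue_measure]_x (f (x + s))%:E = \int[lebesgue_measure]_x (f x)%:E)%E.
Proof.
move=> cf f0.
have dF (x : R) : is_derive x 1 (fun x => x + s) 1.
  by rewrite -[X in is_derive _ _ _ X]addr0; exact: is_deriveD.
have F'E : (fun x : R => x + s)^`()%classic = cst 1.
  by apply/funext => x; rewrite derive1E; case: (dF x).
rewrite [RHS](increasing_ge0_integration_by_substitutionT (F := fun x => x + s))//.
- by apply: eq_integral => x _; rewrite F'E /= fctE /= mulr1.
- by move=> x y xy; rewrite ltrD2r.
- by rewrite F'E; exact: cst_continuous.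
- by rewrite F'E; exact: is_cvg_cst.
- by rewrite F'E; exact: is_cvg_cst.
- apply/cvgrNyPle => A; near=> x; rewrite -lerBrDr; near: x.
  by apply: nbhs_ninfty_le; exact: num_real.
- apply/cvgryPge => A; near=> x; rewrite -lerBlDr; near: x.
  by apply: nbhs_pinfty_ge; exact: num_real.
Unshelve. all: by end_near. Qed.

Section power_kernel.
Context {R : realType}.
Variable alpha : R.
Local Notation mu := (@lebesgue_measure R).

(** Integrand of [Gamma (1 - alpha)] after the substitution [x = exp v]. *)
Definition gamma_kernel (v : R) : R := expR ((1 - alpha) * v - expR v).

Lemma continuous_gamma_kernel : continuous gamma_kernel.
Proof.
move=> x; apply: continuous_comp; last exact: continuous_expR.
apply: continuousB; last exact: continuous_expR.
by apply: continuousM; [exact: cst_continuous|exact: cvg_id].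
Qed.

Let ck := continuous_gamma_kernel.

Lemma gamma_kernel_ge0 v : 0 <= gamma_kernel v. Proof. exact: expR_ge0. Qed.

Let caff (a : R) : continuous (fun s : R => expR (a * s)).
Proof.
move=> x; apply: continuous_comp; last exact: continuous_expR.
by apply: continuousM; [exact: cst_continuous|exact: cvg_id].
Qed.

Let cshift (u : R) : continuous (fun s : R => gamma_kernel (u + s)).
Proof.
move=> x; apply: continuous_comp; last exact: ck.
by apply: continuousD; [exact: cst_continuous|exact: cvg_id].
Qed.

(** Since [(1 - alpha) * (u + s) + alpha * s = (u + s) - alpha * u], the integrand is the
    [s]-derivative of [- exp (- exp (u + s)) * exp (- alpha * u)]. *)
Lemma gamma_kernel_FTC (u b : R) : 0 <= b ->
  (\int[mu]_(s in `[0%R, b]) (gamma_kernel (u + s) * expR (alpha * s))%:E =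
   ((expR (- expR u) - expR (- expR (u + b))) * expR (- alpha * u))%:E)%E.
Proof.
move=> b0.
pose F s := - (expR (- expR (u + s)) * expR (- alpha * u)).
have dF (x : R) : is_derive x 1 F (gamma_kernel (u + x) * expR (alpha * x)).
  rewrite /gamma_kernel -expRD.
  rewrite (_ : _ + _ = - expR (u + x) + (u + x) + - alpha * u); last by ring.
  rewrite (expRD _ (- alpha * u)) (expRD (- expR _)); apply: is_derive_eq.
  rewrite ?scaler0 ?add0r ?addr0.
  rewrite /GRing.scale /=; ring.
rewrite (FTC2_derivable b0 _ dF).
  by rewrite /F addr0; congr EFin; ring.
move=> x.
by apply: (@continuousM _ _ (fun s : R => gamma_kernel (u + s)) (fun s : R => expR (alpha * s)));
  [exact: cshift|exact: caff].
Qed.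

(** Expand the difference as an integral over [s] and exchange the integrals: by translation
    invariance the integral of [gamma_kernel (u + s)] over [u] does not depend on [s], and the
    double integral factors. *)
Lemma tonelli_gamma_kernel (b : R) : 0 <= b ->
  (\int[mu]_u ((expR (- expR u) - expR (- expR (u + b))) * expR (- alpha * u))%:E =
   (\int[mu]_u (gamma_kernel u)%:E) *
     \int[mu]_(s in `[0%R, b]) (expR (alpha * s))%:E)%E.
Proof.
move=> b0.
pose f (us : R * R) : \bar R :=
  (gamma_kernel (us.1 + us.2) * expR (alpha * us.2) * \1_(`[0, b]%classic) us.2)%:E.
have f0 us : (0 <= f us)%E by rewrite lee_fin !mulr_ge0 ?expR_ge0.
have mf : measurable_fun setT f.
  apply/measurable_EFinP/measurable_funM; first apply: measurable_funM.
  - apply: (measurableT_comp (continuous_measurable_fun ck)).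
    exact: measurable_funD.
  - apply: (@measurableT_comp _ _ _ _ _ _ (fun s : R => expR (alpha * s))) => //.
    exact: continuous_measurable_fun.
  - by apply: measurableT_comp => //; exact: measurable_indic.
have := @fubini_tonelli _ _ _ _ _ mu mu f mf f0.
set A := integral _ _ _; set B := integral _ _ _ => AB.
transitivity A.
  apply: eq_integral => u _; rewrite -gamma_kernel_FTC//.
  rewrite integral_mkcond; apply: eq_integral => s _; rewrite /f /= patchE indicE.
  by case: ifPn => _; rewrite ?mulr1 ?mulr0.
rewrite AB /B; set C := (\int[mu]_u (gamma_kernel u)%:E)%E.
have C0 : (0 <= C)%E by apply: integral_ge0 => u _; rewrite lee_fin expR_ge0.
have mexp : measurable_fun `[0, b]%classic (fun s : R => (expR (alpha * s))%:E).
  apply/measurable_EFinP/measurable_funTS; apply: continuous_measurable_fun.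
  by move=> x; exact: (@caff alpha x).
rewrite -ge0_integralZl//.
rewrite [RHS]integral_mkcond; apply: eq_integral => s _.
have -> : (\int[mu]_x f (x, s) =
    \int[mu]_x ((expR (alpha * s) * \1_(`[0%R, b]%classic) s)%:E *
               (gamma_kernel (x + s))%:E))%E.
  by apply: eq_integral => x _; rewrite /f /= -EFinM -mulrA mulrC.
have mg : measurable_fun [set: R] (fun x : R => (gamma_kernel (x + s))%:E).
  apply/measurable_EFinP; apply: continuous_measurable_fun => x.
  apply: continuous_comp; last exact: ck.
  by apply: continuousD; [exact: cvg_id|exact: cst_continuous].
rewrite (ge0_integralZl mu measurableT mg).
- rewrite (ge0_integral_translation s ck gamma_kernel_ge0) patchE indicE -/C.
  by case: ifPn => _; rewrite ?mulr1 ?mulr0 ?mul0e// muleC.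
- by move=> x _; rewrite lee_fin expR_ge0.
- by rewrite lee_fin mulr_ge0 ?expR_ge0.
Qed.

(** The integral of [x ^ (alpha - 1)] from 1 to [n], hence nonnegative whatever the sign of
    [alpha]. *)
Definition power_primitive (n : nat) : R :=
  if alpha == 0 then ln n%:R else (n%:R `^ alpha - 1) / alpha.

Lemma integral_expR_ln (n : nat) : (0 < n)%N ->
  (\int[mu]_(s in `[0%R, ln n%:R]) (expR (alpha * s))%:E =
    (power_primitive n)%:E)%E.
Proof.
move=> n0; have ln0 : 0 <= ln (n%:R : R) by rewrite ln_ge0// ler1n.
rewrite /power_primitive; case: eqVneq => [a0|a0].
  have dF (x : R) : is_derive x 1 (@id R) (expR (alpha * x)).
    by rewrite a0 mul0r expR0; exact: is_derive_id.
  by rewrite (FTC2_derivable ln0 (@caff alpha) dF) subr0.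
have dF (x : R) : is_derive x 1 (fun s => alpha^-1 * expR (alpha * s)) (expR (alpha * x)).
  apply: is_derive_eq; rewrite ?scaler0 ?add0r ?addr0.
  by rewrite /GRing.scale /= mulr1 mulrCA mulVf// mulr1.
rewrite (FTC2_derivable ln0 (@caff alpha) dF) mulr0 expR0 mulrC.
congr EFin; rewrite mulr1 mulrBl div1r; congr (_ - _); rewrite mulrC [in RHS]mulrC.
by rewrite /powR pnatr_eq0 eqn0Ngt n0.
Qed.

(** For [b = ln n], the shift of [u] by [b] turns [exp (- exp u)] into its [n]-th power. *)
Lemma power_kernel_integral (n : nat) : (0 < n)%N ->
  (\int[mu]_u ((expR (- expR u) - expR (- expR u) ^+ n) * expR (- alpha * u))%:E =
   (\int[mu]_u (gamma_kernel u)%:E) * (power_primitive n)%:E)%E.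
Proof.
move=> n0; have n0' : (0 : R) < n%:R by rewrite ltr0n.
rewrite -integral_expR_ln// -tonelli_gamma_kernel ?ln_ge0 ?ler1n//.
apply: eq_integral => u _; rewrite -expRM_natl expRD lnK// mulrN.
by rewrite [n%:R * _]mulrC.
Qed.

End power_kernel.

(** * Integrability from exponential tails *)

Section integrability.
Context {R : realType}.
Local Notation mu := (@lebesgue_measure R).

(** Comparison with a two-sided exponential: on the positive half-line it is a multiple of the
    exponential density, and the negative half-line follows by reflection. *)
Lemma ge0_integral_lty_expR_abs (f : R -> R) (K e : R) : 0 < e ->
  measurable_fun setT f -> (forall u, 0 <= f u <= K * expR (- e * `|u|)) ->
  (\int[mu]_u (f u)%:E < +oo)%E.
Proof.
move=> e0 mf f0K; pose D (u : R) := expR (- e * `|u|).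
have K0 : 0 <= K.
  have /andP[a b] := f0K 0; have := le_trans a b.
  by rewrite normr0 mulr0 expR0 mulr1.
have cD : continuous D.
  move=> x; apply: continuous_comp; last exact: continuous_expR.
  by apply: continuousM; [exact: cst_continuous|exact: norm_continuous].
have mD : measurable_fun setT D by exact: continuous_measurable_fun.
have D0 u : 0 <= D u by exact: expR_ge0.
have Dy : (\int[mu]_(u in `[0%R, +oo[) (D u)%:E < +oo)%E.
  have mpdf := measurable_exponential_pdf e.
  have -> : (\int[mu]_(u in `[0%R, +oo[) (D u)%:E =
      \int[mu]_(u in `[0%R, +oo[) (e^-1%:E * (exponential_pdf e u)%:E))%E.
    apply: eq_integral => u; rewrite inE /= in_itv/= andbT => u0.
    rewrite exponential_pdfE// -EFinM mulrA mulVf ?gt_eqF// mul1r /D.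
    by rewrite ger0_norm.
  rewrite ge0_integralZl//; last 3 first.
  - by apply/measurable_EFinP; exact: measurable_funTS.
  - by move=> u _; rewrite lee_fin exponential_pdf_ge0// ltW.
  - by rewrite lee_fin invr_ge0 ltW.
  rewrite lte_mul_pinfty ?lee_fin ?invr_ge0 ?ltW//.
  apply: (@le_lt_trans _ _ (\int[mu]_u (exponential_pdf e u)%:E)%E); last first.
    by rewrite integral_exponential_pdf// ltry.
  apply: ge0_subset_integral => //; first exact/measurable_EFinP.
  by move=> u _; rewrite lee_fin exponential_pdf_ge0// ltW.
have DNy : (\int[mu]_(u in `]-oo, 0%R]) (D u)%:E < +oo)%E.
  have := @ge0_integration_by_substitutionNy R D 0.
  rewrite oppr0 => -> //.
  - rewrite (_ : D \o -%R = D)//.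
    by apply/funext => u; rewrite /= /D normrN.
  - exact: continuous_subspaceT.
have DT : (\int[mu]_u (D u)%:E < +oo)%E.
  rewrite (_ : [set: R] = `]-oo, 0] `|` `]0, +oo[)%classic; last first.
    apply/seteqP; split=> // u _ /=; rewrite !in_itv/= andbT.
    by case: (leP u 0); [left|right].
  rewrite ge0_integral_setU//=; last 3 first.
  - by apply/measurable_EFinP; exact: measurable_funTS.
  - by move=> u _; rewrite lee_fin D0.
  - apply/disj_set2P; rewrite -subset0 => u [] /=; rewrite !in_itv/= andbT.
    by rewrite leNgt => /negP.
  rewrite lte_add_pinfty// (le_lt_trans _ Dy)//.
  apply: ge0_subset_integral => //.
  - by apply/measurable_EFinP; exact: measurable_funTS.
  - by move=> u _; rewrite lee_fin D0.
  - by move=> u /=; rewrite !in_itv/= !andbT => /ltW.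
apply: (@le_lt_trans _ _ (\int[mu]_u (K%:E * (D u)%:E))%E).
  apply: ge0_le_integral => //.
  - by move=> u _; rewrite lee_fin; case/andP: (f0K u).
  - exact/measurable_EFinP.
  - by apply/measurable_EFinP; apply: measurable_funM.
  - by move=> u _; rewrite -EFinM lee_fin; case/andP: (f0K u).
have mD' : measurable_fun [set: R] (fun u => (D u)%:E) by exact/measurable_EFinP.
rewrite (ge0_integralZl mu measurableT mD')//; first by rewrite lte_mul_pinfty.
by move=> u _; rewrite lee_fin D0.
Qed.

(** The exponential lies above its tangent at [ln b], where [b = |a| + 1]. This [b] makes the
    resulting slope [a - b] at most -1, so for [u >= 0] the bound decays at every rate [e <= 1]. *)
Lemma expR_ge_tangent (a u : R) : a * u - expR u <=
  (`|a| + 1) * ln (`|a| + 1) - (`|a| + 1) + (a - (`|a| + 1)) * u.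
Proof.
set b := `|a| + 1; have b0 : 0 < b by rewrite ltr_wpDl.
have : b * (1 + (u - ln b)) <= b * expR (u - ln b).
  by apply: ler_wpM2l; [exact: ltW|exact: expR_ge1Dx].
by rewrite expRD expRN lnK// mulrCA divff ?gt_eqF// mulr1; lra.
Qed.

Lemma expR_double_exp_le (a e u : R) : 0 < e <= 1 -> 0 <= u ->
  expR (a * u - expR u) <=
  expR ((`|a| + 1) * ln (`|a| + 1) - (`|a| + 1)) * expR (- e * `|u|).
Proof.
move=> /andP[e0 e1] u0; rewrite (ger0_norm u0) -expRD ler_expR.
apply: (le_trans (expR_ge_tangent _ _)); rewrite lerD2l.
apply: ler_wpM2r => //; have := ler_norm a; lra.
Qed.

End integrability.


(** * The deficit [z - g z] integrated against the power kernel *)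

Section tree_integral.
Context {R : realType}.
Local Notation mu := (@lebesgue_measure R).
Variable alpha : R.
Hypothesis alpha_lt : alpha < 2^-1.

Let eps := Num.min (2^-1 - alpha) 1.
Let eps01 : 0 < eps <= 1.
Proof. by rewrite /eps lt_min subr_gt0 alpha_lt ltr01 ge_min lexx orbT. Qed.
Let eps_gt0 : 0 < eps. Proof. by case/andP: eps01. Qed.
Let eps_le : eps <= 2^-1 - alpha. Proof. by rewrite /eps ge_min lexx. Qed.

Lemma continuous_expR_opp_expR : continuous (fun u : R => expR (- expR u)).
Proof.
move=> x; apply: continuous_comp; last exact: continuous_expR.
by apply: continuousN; exact: continuous_expR.
Qed.

Lemma measurable_expR_opp_expR :
  measurable_fun [set: R] (fun u : R => expR (- expR u)).
Proof.
by apply: continuous_measurable_fun => x; exact: continuous_expR_opp_expR.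
Qed.

Lemma measurable_expR_mul (a : R) :
  measurable_fun [set: R] (fun u : R => expR (a * u)).
Proof.
apply: continuous_measurable_fun => x.
apply: continuous_comp; last exact: continuous_expR.
by apply: continuousM; [exact: cst_continuous|exact: cvg_id].
Qed.

(** The double exponential wins for [u >= 0]; for [u < 0] the kernel is at most
    [exp ((1 - alpha) * u)], and [eps <= 1 - alpha]. *)
Lemma integral_gamma_kernel_lty : (\int[mu]_u (gamma_kernel alpha u)%:E < +oo)%E.
Proof.
set a := 1 - alpha; set c := (`|a| + 1) * ln (`|a| + 1) - (`|a| + 1).
apply: (@ge0_integral_lty_expR_abs _ _ (1 + expR c) eps) => //.
  by apply: continuous_measurable_fun => x; exact: continuous_gamma_kernel.
move=> u; rewrite expR_ge0/= mulrDl mul1r.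
have [u0|u0] := leP 0 u.
  by rewrite (le_trans (expR_double_exp_le _ eps01 u0))// lerDr expR_ge0.
rewrite (@le_trans _ _ (expR (- eps * `|u|)))//; last first.
  by rewrite lerDl mulr_ge0// expR_ge0.
rewrite ler_expR ltr0_norm// mulrNN.
have ae : eps <= a by apply: (le_trans eps_le); rewrite /a; lra.
have : (a - eps) * u <= 0 by rewrite mulr_ge0_le0 ?subr_ge0// ltW.
by have := expR_ge0 u; rewrite /a; lra.
Qed.

Lemma expR_opp_expR01 (u : R) : 0 < expR (- expR u) < 1.
Proof. by rewrite expR_gt0 expR_lt1 oppr_lt0 expR_gt0. Qed.

Let z01 (u : R) : 0 <= expR (- expR u) <= 1.
Proof. by have /andP[a b] := expR_opp_expR01 u; rewrite !ltW. Qed.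

Section one_law.
Variables (p : nat -> R) (Phi : R -> R).
Hypothesis H : critical_pgf p Phi.
Let p0 := cpgf_ge0 H.

Lemma measurable_gw_pgf : measurable_fun setT (fun u => gw_pgf p (expR (- expR u))).
Proof.
apply/measurable_EFinP.
rewrite (_ : _ \o _ = fun u => (\esum_(t in [set: ptree]) (gw_term p (expR (- expR u)) t)%:E)%E).
  apply: measurable_esum => t.
    apply/measurable_EFinP; apply: measurable_funM => //.
    by apply: measurable_funX; exact: measurable_expR_opp_expR.
  by move=> u; rewrite lee_fin gw_term_ge0//; case/andP: (z01 u).
by apply/funext => u; rewrite (esum_gw_term H).
Qed.

Definition mean_power_primitive : \bar R :=
  (\esum_(t in [set: ptree])
     (power_primitive alpha (Defs.tsize t) * gw_weight p t)%:E)%E.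

Lemma power_primitive_ge0 n : (0 < n)%N -> 0 <= power_primitive alpha n.
Proof.
move=> n0; rewrite -lee_fin -integral_expR_ln//.
by apply: integral_ge0 => x _; rewrite lee_fin expR_ge0.
Qed.

Lemma esum_gw_weight : (\esum_(t in [set: ptree]) (gw_weight p t)%:E = 1)%E.
Proof.
have h1 : 0 <= (1 : R) <= 1 by rewrite ler01 lexx.
rewrite -(gw_pgf1 H) -(esum_gw_term H h1); apply: eq_esum => t _.
by rewrite /gw_term expr1n mul1r.
Qed.

(** The tree weights sum to 1, so [z] itself is the sum of [z * gw_weight p t]. *)
Lemma esum_deficit z : 0 <= z <= 1 ->
  (\esum_(t in [set: ptree]) ((z - z ^+ Defs.tsize t) * gw_weight p t)%:E =
   (z - gw_pgf p z)%:E)%E.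
Proof.
move=> z01'; have /andP[z0 z1] := z01'.
have d0 t : 0 <= z - z ^+ Defs.tsize t.
  by rewrite subr_ge0 -{2}[z]expr1 ler_wiXn2l// tsize_gt0.
set S := esum _ _.
(* Moving [gw_pgf p z] to the left leaves only sums of nonnegative terms, which may be added
   termwise. *)
suff : (S + (gw_pgf p z)%:E = z%:E)%E.
  case: S => [r||]//; rewrite -EFinD => -[zE]; congr EFin; lra.
rewrite -(esum_gw_term H z01') -esumD => [|t _|t _]; last 2 first.
- by rewrite lee_fin mulr_ge0// gw_weight_ge0.
- by rewrite lee_fin gw_term_ge0.
rewrite -[RHS]mule1 -esum_gw_weight -esumZl// => [|t _]; last first.
  by rewrite lee_fin gw_weight_ge0.
by apply: eq_esum => t _; rewrite -EFinD -EFinM /gw_term mulrBl subrK.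
Qed.

(** Tonelli over trees and [u], then [power_kernel_integral] tree by tree. The Gamma integral is
    finite, so it leaves the sum as a real scalar. *)
Lemma integral_deficit :
  (\int[mu]_u ((expR (- expR u) - gw_pgf p (expR (- expR u))) * expR (- alpha * u))%:E
   = (\int[mu]_u (gamma_kernel alpha u)%:E) * mean_power_primitive)%E.
Proof.
have C0 : (0 <= \int[mu]_u (gamma_kernel alpha u)%:E)%E.
  by apply: integral_ge0 => u _; rewrite lee_fin expR_ge0.
have Cfin : (\int[mu]_u (gamma_kernel alpha u)%:E)%E \is a fin_num.
  by rewrite ge0_fin_numE// integral_gamma_kernel_lty.
rewrite -(fineK Cfin) -esumZl ?fine_ge0//; last first.
  by move=> t _; rewrite lee_fin mulr_ge0 ?gw_weight_ge0// power_primitive_ge0// tsize_gt0.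
pose h t u : \bar R := ((gw_weight p t)%:E *
  (((expR (- expR u) - expR (- expR u) ^+ Defs.tsize t)) * expR (- alpha * u))%:E)%E.
have h00 t u : (0 <= (((expR (- expR u) - expR (- expR u) ^+ Defs.tsize t)) * expR (- alpha * u))%:E)%E.
  have /andP[z0 z1] := z01 u.
  by rewrite lee_fin mulr_ge0 ?expR_ge0// subr_ge0 -{2}[expR (- expR u)]expr1 ler_wiXn2l// tsize_gt0.
have h0 t u : (0 <= h t u)%E by rewrite mule_ge0// lee_fin gw_weight_ge0.
have mh0 t : measurable_fun [set: R] (fun u => (((expR (- expR u) - expR (- expR u) ^+ Defs.tsize t)) * expR (- alpha * u))%:E).
  apply/measurable_EFinP; apply: measurable_funM; last exact: measurable_expR_mul.
  apply: measurable_funB; first exact: measurable_expR_opp_expR.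
  by apply: measurable_funX; exact: measurable_expR_opp_expR.
have mh t : measurable_fun [set: R] (h t) by apply: measurable_funeM.
transitivity (\int[mu]_u (\esum_(t in [set: ptree]) h t u))%E.
  apply: eq_integral => u _; rewrite EFinM -esum_deficit// muleC -esumZl ?expR_ge0//.
    by apply: eq_esum => t _; rewrite /h -!EFinM; congr EFin; ring.
  move=> t _; rewrite lee_fin mulr_ge0 ?gw_weight_ge0//.
  have := h00 t u; rewrite lee_fin pmulr_lge0//; exact: expR_gt0.
rewrite integral_esum//; apply: eq_esum => t _.
rewrite (ge0_integralZl mu measurableT (mh0 t))//; last by rewrite lee_fin gw_weight_ge0.
rewrite power_kernel_integral ?tsize_gt0// fineK//.
by rewrite muleCA -EFinM mulrC.
Qed.

End one_law.
End tree_integral.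

(** * Comparison of two offspring laws *)

Section comparison.
Context {R : realType}.
Local Notation mu := (@lebesgue_measure R).

(** Put [x = exp u <= 1] and [z = exp (- x)]. Then [z >= 1/4] and [1 - z <= x], so [gw_pgf_quad]
    gives [(1 - g) ^ 2 <= 16 * x]. *)
Lemma deficit_le_sqrt (p : nat -> R) (Phi : R -> R) (u : R) :
  critical_pgf p Phi -> u <= 0 ->
  expR (- expR u) - gw_pgf p (expR (- expR u)) <= 4 * expR (u / 2).
Proof.
move=> H u0; have /andP[z0 z1] := expR_opp_expR01 u.
have z01 : 0 <= expR (- expR u) <= 1 by rewrite !ltW.
have := gw_pgf_quad H z01; have /andP[g0 g1] := gw_pgf_01 H z01.
have x1 : expR u <= 1 by rewrite -expR0 ler_expR.
(* Square [exp (- x / 2) >= 1 - x / 2 >= 1/2]. *)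
have z4 : 4^-1 <= expR (- expR u).
  have h : 1 + - expR u / 2 <= expR (- expR u / 2) by exact: expR_ge1Dx.
  have -> : expR (- expR u) = expR (- expR u / 2) ^+ 2.
    by rewrite -expRM_natl; congr expR; field.
  rewrite (_ : 4^-1 = 2^-1 ^+ 2); last by field.
  by rewrite ler_pXn2r ?nnegrE ?expR_ge0 ?invr_ge0//; lra.
have zx : 1 - expR u <= expR (- expR u) by exact: expR_ge1Dx.
have xE : expR u = expR (u / 2) ^+ 2 by rewrite -expRM_natl; congr expR; field.
have := expR_gt0 (u / 2).
move: (expR (u / 2)) (expR (- expR u)) (gw_pgf p _) z0 z1 z01 g0 g1 z4 zx xE.
move=> y z g z0 z1 _ g0 g1 z4 zx xE y0 q.
apply: (@le_trans _ _ (1 - g)); first by rewrite lerB// ltW.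
have y4 : 0 <= 4 * y by rewrite mulr_ge0// ltW.
have g10 : 0 <= 1 - g by rewrite subr_ge0.
rewrite -(@ler_pXn2r _ 2) ?nnegrE//.
have : 4^-1 * (1 - g) ^+ 2 <= z * (1 - g) ^+ 2 by rewrite ler_wpM2r// sqr_ge0.
by rewrite exprMn -xE; lra.
Qed.

Lemma integral_deficit_lty (alpha : R) (p : nat -> R) (Phi : R -> R) :
  alpha < 2^-1 -> critical_pgf p Phi ->
  (\int[mu]_u ((expR (- expR u) - gw_pgf p (expR (- expR u))) * expR (- alpha * u))%:E
   < +oo)%E.
Proof.
move=> alpha_lt H.
(* The rate [1/2 - alpha] is what the square-root bound leaves as [u] tends to -oo; the cap at 1 is
   the rate allowed by [expR_double_exp_le] for [u >= 0]. *)
pose eps := Num.min (2^-1 - alpha) 1.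
have eps01 : 0 < eps <= 1.
  by rewrite /eps lt_min subr_gt0 alpha_lt ltr01 ge_min lexx orbT.
have /andP[eps0 eps1] := eps01.
have epsle : eps <= 2^-1 - alpha by rewrite /eps ge_min lexx.
set a := - alpha; set c := (`|a| + 1) * ln (`|a| + 1) - (`|a| + 1).
apply: (@ge0_integral_lty_expR_abs _ _ (4 + expR c) eps) => //.
  apply: measurable_funM; last exact: measurable_expR_mul.
  by apply: measurable_funB;
    [exact: measurable_expR_opp_expR|exact: measurable_gw_pgf H].
move=> u; have /andP[z0 z1] := expR_opp_expR01 u.
have z01 : 0 <= expR (- expR u) <= 1 by rewrite !ltW.
have gz := gw_pgf_le H z01; have /andP[g0 _] := gw_pgf_01 H z01.
rewrite mulr_ge0 ?subr_ge0 ?expR_ge0//= [(4 + _) * _]mulrDl.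
have [u0|u0] := leP 0 u.
  apply: (@le_trans _ _ (expR (a * u - expR u))).
    by rewrite [a * u - _]addrC expRD ler_wpM2r ?expR_ge0// gerBl.
  by rewrite (le_trans (expR_double_exp_le _ eps01 u0))// lerDr mulr_ge0 ?expR_ge0.
apply: (@le_trans _ _ (4 * expR (- eps * `|u|))); last first.
  by rewrite lerDl mulr_ge0 ?expR_ge0.
apply: (@le_trans _ _ (4 * expR (u / 2) * expR (a * u))).
  by rewrite ler_wpM2r ?expR_ge0// (deficit_le_sqrt H)// ltW.
rewrite -mulrA ler_wpM2l// -expRD ler_expR ltr0_norm// mulrNN.
have : (2^-1 - alpha - eps) * u <= 0 by rewrite mulr_ge0_le0 ?subr_ge0// ltW.
by rewrite /a; lra.
Qed.

(** If the integral vanished, [f] would be zero almost everywhere, and a null set would contain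
    [[0, 1]]. *)
Lemma integral_pos_gt0 (f : R -> R) : measurable_fun setT f ->
  (forall u, 0 < f u) -> (0 < \int[mu]_u (f u)%:E)%E.
Proof.
move=> mf f0; rewrite lt_def integral_ge0 ?andbT; last first.
  by move=> u _; rewrite lee_fin ltW.
apply/negP => /eqP i0.
have mf' : measurable_fun [set: R] (EFin \o f) by exact/measurable_EFinP.
have : (\int[mu]_u `|(EFin \o f) u| = 0)%E.
  by rewrite -[RHS]i0; apply: eq_integral => u _; rewrite /= gtr0_norm.
move=> /(ae_eq_integral_abs mu measurableT mf') [A [mA A0 NA]].
have : (mu `[0%R, 1%R]%classic <= mu A)%E.
  apply: le_measure; rewrite ?inE// => u _; apply: NA => /= /(_ I) [] /eqP.
  by rewrite gt_eqF.
by rewrite A0 lebesgue_measure_itv/= lte_fin ltr01 oppr0 adde0 lee_fin ler10.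
Qed.

Variables (p1 p2 : nat -> R) (Phi1 Phi2 : R -> R).
Hypotheses (H1 : critical_pgf p1 Phi1) (H2 : critical_pgf p2 Phi2).
Hypothesis lt12 : forall s : R, 0 < s < 1 -> Phi1 s < Phi2 s.

(** The deficit integral of the first law is that of the second, [J2], plus the integral of the
    positive function [D]. Finiteness of [J2] keeps the inequality strict, and monotonicity of
    multiplication by [C >= 0] removes the factor [C] by contraposition. *)
Lemma mean_power_primitive_lt (alpha : R) : alpha < 2^-1 ->
  (mean_power_primitive alpha p2 < mean_power_primitive alpha p1)%E.
Proof.
move=> alpha_lt; set C := (\int[mu]_u (gamma_kernel alpha u)%:E)%E.
have C0 : (0 <= C)%E by apply: integral_ge0 => u _; rewrite lee_fin expR_ge0.
suff lt : (C * mean_power_primitive alpha p2 < C * mean_power_primitive alpha p1)%E.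
  rewrite ltNge; apply/negP => le; move: lt; rewrite ltNge => /negP; apply.
  exact: lee_wpmul2l.
rewrite -(integral_deficit alpha_lt H1) -(integral_deficit alpha_lt H2).
set J2 := integral _ _ _.
have z01 (u : R) : 0 <= expR (- expR u) <= 1.
  by have /andP[z0 z1] := expR_opp_expR01 u; rewrite !ltW.
have me := measurable_expR_mul (- alpha).
have mz := @measurable_expR_opp_expR R.
pose D (u : R) := (gw_pgf p2 (expR (- expR u)) - gw_pgf p1 (expR (- expR u))) * expR (- alpha * u).
have mD : measurable_fun [set: R] D.
  by apply: measurable_funM => //; apply: measurable_funB;
    [exact: measurable_gw_pgf H2|exact: measurable_gw_pgf H1].
have D0 u : 0 < D u.
  rewrite mulr_gt0 ?expR_gt0// subr_gt0.
  exact: (gw_pgf_lt H1 H2 lt12 (expR_opp_expR01 u)).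
have J20 : (0 <= J2)%E.
  apply: integral_ge0 => u _.
  by rewrite lee_fin mulr_ge0 ?expR_ge0// subr_ge0 (gw_pgf_le H2).
have J2fin : J2 \is a fin_num.
  by rewrite ge0_fin_numE// (integral_deficit_lty alpha_lt H2).
rewrite (_ : integral _ _ _ = J2 + \int[mu]_u (D u)%:E)%E; last first.
  rewrite -ge0_integralD//.
  - by apply: eq_integral => u _; rewrite -EFinD /D; congr EFin; ring.
  - by move=> u _; rewrite lee_fin mulr_ge0 ?expR_ge0// subr_ge0 (gw_pgf_le H2).
  - apply/measurable_EFinP; apply: measurable_funM => //; apply: measurable_funB => //.
    exact: measurable_gw_pgf H2.
  - by move=> u _; rewrite lee_fin ltW.
  - exact/measurable_EFinP.
by rewrite -{1}[J2]adde0 lteD2lE// integral_pos_gt0.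
Qed.

Lemma gw_mu'_lt : (gw_mu' p2 < gw_mu' p1)%E.
Proof.
have muE p : gw_mu' p = mean_power_primitive (0 : R) p.
  by apply: eq_esum => t _; rewrite /power_primitive eqxx.
by rewrite !muE mean_power_primitive_lt// invr_gt0.
Qed.

Lemma gw_mu_lt_pos (alpha : R) : 0 < alpha -> alpha < 2^-1 ->
  (gw_mu p2 alpha < gw_mu p1 alpha)%E.
Proof.
move=> a0 a1.
have muE p Phi : critical_pgf p Phi ->
    (gw_mu p alpha = 1 + alpha%:E * mean_power_primitive alpha p)%E.
  move=> H; rewrite -(esum_gw_weight H) -esumZl ?ltW// => [|t _]; last first.
    by rewrite lee_fin mulr_ge0 ?gw_weight_ge0 ?power_primitive_ge0 ?tsize_gt0//; exact: cpgf_ge0 H.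
  rewrite -esumD => [|t _|t _].
  - apply: eq_esum => t _; rewrite -EFinM -EFinD; congr EFin.
    rewrite /power_primitive gt_eqF//.
    by field; rewrite gt_eqF.
  - by rewrite lee_fin gw_weight_ge0//; exact: cpgf_ge0 H.
  - by rewrite -EFinM lee_fin !mulr_ge0 ?gw_weight_ge0 ?power_primitive_ge0 ?tsize_gt0// ?ltW//; exact: cpgf_ge0 H.
rewrite (muE _ _ H1) (muE _ _ H2) lteD2lE// lte_pmul2l//.
exact: mean_power_primitive_lt.
Qed.

Lemma gw_mu_lt_neg (alpha : R) : alpha < 0 ->
  (gw_mu p1 alpha < gw_mu p2 alpha)%E.
Proof.
move=> a0; have alpha_lt : alpha < 2^-1 by rewrite (lt_trans a0)// invr_gt0.
(* For [alpha < 0], [n ^ alpha + (- alpha) * f n = 1] has two nonnegative terms on the left, so it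
   can be summed over trees without subtraction. *)
have muE p Phi : critical_pgf p Phi -> (gw_mu p alpha +
    (- alpha)%:E * mean_power_primitive alpha p = 1)%E.
  move=> H; rewrite -(esum_gw_weight H) -esumZl ?oppr_ge0 ?ltW// => [|t _]; last first.
    by rewrite lee_fin mulr_ge0 ?gw_weight_ge0 ?power_primitive_ge0 ?tsize_gt0//; exact: cpgf_ge0 H.
  rewrite -esumD => [|t _|t _].
  - apply: eq_esum => t _; rewrite -EFinM -EFinD; congr EFin.
    rewrite /power_primitive lt_eqF//.
    by field; rewrite lt_eqF.
  - by rewrite lee_fin mulr_ge0 ?powR_ge0 ?gw_weight_ge0//; exact: cpgf_ge0 H.
  - by rewrite -EFinM lee_fin !mulr_ge0 ?gw_weight_ge0 ?power_primitive_ge0 ?tsize_gt0// ?oppr_ge0 ?ltW//; exact: cpgf_ge0 H.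
have := muE _ _ H1; have := muE _ _ H2; have := mean_power_primitive_lt alpha_lt.
have na0 : 0 < - alpha by rewrite oppr_gt0.
(* An infinite value on the left of [muE] is incompatible with the total 1, so only real values
   remain. *)
move: (gw_mu p1 alpha) (gw_mu p2 alpha) (mean_power_primitive alpha p1)
  (mean_power_primitive alpha p2) => [a||] [b||] [c||] [d||] //=;
  rewrite ?gt0_muley ?gt0_muleNy ?lte_fin//=.
rewrite -!EFinM -!EFinD => dc [bd] [ac].
have : - alpha * d < - alpha * c by rewrite ltr_pM2l.
by lra.
Qed.

End comparison.

(** * The five families of offspring laws *)

Section series_values.
Context {R : realType}.

Lemma nneseries_finite (f : nat -> R) N : (forall k, 0 <= f k) ->
  (forall k, (N <= k)%N -> f k = 0) ->
  (\sum_(k <oo) (f k)%:E = (\sum_(k < N) f k)%:E)%E.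
Proof.
move=> f0 fN; rewrite (nneseries_split 0 N) => [|k _]; last by rewrite lee_fin.
rewrite eseries0 => [|k Nk _]; last by rewrite fN.
by rewrite adde0 sumEFin big_mkord.
Qed.

Lemma cvg_series_eseries (f : nat -> R) (l : R) :
  (series f @ \oo --> l)%classic -> (\sum_(k <oo) (f k)%:E = l%:E)%E.
Proof.
move=> fl; apply/cvg_lim => //; apply: cvg_EFin.
  by apply: nearW => n; rewrite sumEFin.
apply: cvg_trans fl; apply: near_eq_cvg; apply: nearW => n.
by rewrite /= sumEFin.
Qed.

Lemma expR_eseries (x : R) : (\sum_(k <oo) (x ^+ k / k`!%:R)%:E = (expR x)%:E)%E.
Proof. by apply: cvg_series_eseries; exact: is_cvg_series_exp_coeff. Qed.

Lemma expR_ge_quadratic (x : R) : 0 <= x -> 1 + x + x ^+ 2 / 2 <= expR x.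
Proof.
move=> x0; rewrite -lee_fin -expR_eseries.
have h k : 0 <= x ^+ k / k`!%:R by rewrite divr_ge0// exprn_ge0.
apply: le_trans (nneseries_lim_ge 3 _) => [|k _ _]; last by rewrite lee_fin.
rewrite !big_nat_recr//= big_geq// add0e -!EFinD lee_fin !factE /=.
by rewrite expr0 expr1 !divr1.
Qed.

End series_values.

(** * Elementary inequalities for powers *)

Section inequalities.
Context {R : realFieldType}.

(* The left-hand side is the tangent line of [t ^+ m.+1] at [a], taken at [b]. *)
Lemma exprn_gt_tangent (a b : R) m : (0 < m)%N -> 0 <= a < b ->
  a ^+ m * (m.+1%:R * b - m%:R * a) < b ^+ m.+1.
Proof.
move=> + /andP[a0 ab]; have b0 : 0 < b by exact: le_lt_trans ab.
case: m => // m _; elim: m => [|m IH].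
  by have := mulr_gt0 (etrans (subr_gt0 _ _) ab) (etrans (subr_gt0 _ _) ab); rewrite expr2 expr1; lra.
apply: (@le_lt_trans _ _ (b * (a ^+ m.+1 * (m.+2%:R * b - m.+1%:R * a)))); last first.
  by rewrite [ltRHS]exprS ltr_pM2l.
have h : 0 <= a ^+ m.+1 * m.+2%:R * (b - a) ^+ 2 by apply: mulr_ge0; [rewrite mulr_ge0 ?exprn_ge0|exact: sqr_ge0].
rewrite -subr_ge0 [X in 0 <= X](_ : _ = a ^+ m.+1 * m.+2%:R * (b - a) ^+ 2)//.
by rewrite [a ^+ m.+2]exprS -(natr1 m.+2) -(natr1 m.+1); ring.
Qed.

(** A mean value bound, the derivative of the power being at most [m] on [[0, 1]]. It yields the
    contraction property of [pgf1] and [pgf5]. *)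
Lemma exprn_sub_le (s t : R) m : 0 <= t -> t <= s -> s <= 1 ->
  s ^+ m - t ^+ m <= m%:R * (s - t).
Proof.
move=> t0 ts s1; have s0 := le_trans t0 ts; have t1 := le_trans ts s1.
elim: m => [|m IH]; first by rewrite !expr0 subrr mul0r.
have h1 : s * (s ^+ m - t ^+ m) <= s ^+ m - t ^+ m.
  by rewrite ler_piMl// subr_ge0 lerXn2r.
have h2 : (s - t) * t ^+ m <= s - t by rewrite ler_piMr ?subr_ge0// exprn_ile1.
by rewrite !exprS -natr1; lra.
Qed.

End inequalities.

(** * Offspring generating functions and their order *)

Section offspring_laws.
Context {R : realType}.

Definition pgf1 (m : nat) (s : R) : R := (1 - (1 - s) / m%:R) ^+ m.
Definition pgf2 (s : R) : R := expR (s - 1).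
Definition pgf3 (s : R) : R := (1 + s ^+ 2) / 2.
Definition pgf4 (s : R) : R := (2 - s)^-1.
Definition pgf5 (m : nat) (s : R) : R := 1 - (1 - s ^+ m) / m%:R.

(** With [a] and [b] the bases of the two powers, [m.+1 * b - m * a = 1], so the tangent at [a]
    takes at [b] exactly the value [a ^ m]. *)
Lemma pgf1_ltS m (s : R) : (1 < m)%N -> 0 <= s < 1 -> pgf1 m s < pgf1 m.+1 s.
Proof.
move=> m1 /andP[s0 s1]; have m0 : (0 : R) < m%:R by rewrite ltr0n ltnW.
have M0 : (0 : R) < m.+1%:R by rewrite ltr0n.
have mM : (m.+1%:R : R) = m%:R + 1 by rewrite natr1.
rewrite /pgf1; set a := 1 - _ / m%:R; set b := 1 - _ / m.+1%:R.
have a0 : 0 <= a.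
  rewrite subr_ge0 ler_pdivrMr// mul1r (@le_trans _ _ 1)//; first by rewrite gerBl.
  by rewrite ler1n ltnW.
have ab : a < b.
  by rewrite ltrD2l ltrN2 ltr_pM2l ?subr_gt0// ltf_pV2 ?posrE// ltr_nat.
have := @exprn_gt_tangent R a b m (ltnW m1); rewrite a0 ab => /(_ isT).
suff -> : m.+1%:R * b - m%:R * a = 1 by rewrite mulr1.
by rewrite /a /b; move: M0; rewrite mM => M0; field; rewrite !gt_eqF.
Qed.

Lemma pgf1_lt m n (s : R) : (1 < m)%N -> (m < n)%N -> 0 <= s < 1 ->
  pgf1 m s < pgf1 n s.
Proof.
move=> m1 + s01; elim: n => // n IH; rewrite ltnS leq_eqVlt => /predU1P[<-|mn].
  exact: pgf1_ltS.
by rewrite (lt_trans (IH mn))// pgf1_ltS// (ltn_trans m1).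
Qed.

(** Raise [1 - x < exp (- x)] to the power [m], for [x = (1 - s) / m]. *)
Lemma pgf1_lt_pgf2 m (s : R) : (1 < m)%N -> 0 <= s < 1 -> pgf1 m s < pgf2 s.
Proof.
move=> m1 /andP[s0 s1]; have m0 : (0 : R) < m%:R by rewrite ltr0n ltnW.
rewrite /pgf1 /pgf2 (_ : s - 1 = m%:R * (- ((1 - s) / m%:R))); last first.
  by field; rewrite gt_eqF.
rewrite expRM_natl ltrXn2r ?gtn_eqF// ?(ltnW m1)//.
  rewrite subr_ge0 ler_pdivrMr// mul1r (@le_trans _ _ 1)//; first by rewrite gerBl.
  by rewrite ler1n ltnW.
by apply: expR_gt1Dx; rewrite oppr_eq0 gt_eqF// divr_gt0// subr_gt0.
Qed.

Lemma pgf2_lt_pgf3 (s : R) : 0 <= s < 1 -> pgf2 s < pgf3 s.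
Proof.
move=> /andP[s0 s1]; rewrite /pgf2 /pgf3.
have x0 : 0 < 1 - s by rewrite subr_gt0.
rewrite -opprB expRN -[ltRHS]invrK ltf_pV2 ?posrE ?expR_gt0 ?invr_gt0//; last first.
  by rewrite divr_gt0// ltr_wpDr ?sqr_ge0.
apply: lt_le_trans (expR_ge_quadratic (ltW x0)).
have q0 : 0 < 1 + s ^+ 2 by rewrite ltr_wpDr ?sqr_ge0.
rewrite invf_div ltr_pdivrMr// -subr_gt0.
(* For [x = 1 - s], [(1 + x + x ^ 2 / 2) * (1 + s ^ 2) = 2 + x ^ 4 / 2]. *)
have : 0 < (1 - s) ^+ 4 / 2 by rewrite divr_gt0// exprn_gt0.
by congr (0 < _); field.
Qed.

(** Clearing denominators leaves [s * (1 - s) ^ 2 > 0]. Both functions equal 1/2 at 0, which is why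
    the laws are compared on the open interval. *)
Lemma pgf3_lt_pgf4 (s : R) : 0 < s < 1 -> pgf3 s < pgf4 s.
Proof.
move=> /andP[s0 s1]; rewrite /pgf3 /pgf4 -[ltRHS]div1r ltr_pdivlMr; last by lra.
have : 0 < s * (1 - s) ^+ 2 by rewrite mulr_gt0// exprn_gt0// subr_gt0.
by lra.
Qed.

Lemma pgf4_lt_pgf5 (s : R) : 0 <= s < 1 -> pgf4 s < pgf5 3 s.
Proof.
move=> /andP[s0 s1]; rewrite /pgf5 /pgf4 -[ltLHS]div1r ltr_pdivrMr; last by lra.
have : 0 < (1 - s) ^+ 3 * (1 + s) by rewrite mulr_gt0 ?exprn_gt0// ?subr_gt0//; lra.
by lra.
Qed.

(** The tangent of [t ^ m.+1] at [s], taken at 1, gives [s ^ m * (m.+1 - m * s) < 1], which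
    rearranges to the claim. *)
Lemma pgf5_ltS m (s : R) : (0 < m)%N -> 0 <= s < 1 -> pgf5 m s < pgf5 m.+1 s.
Proof.
move=> m0 s01; have := exprn_gt_tangent m0 s01.
have m0' : (0 : R) < m%:R by rewrite ltr0n.
rewrite /pgf5 expr1n ltrD2l ltrN2 ltr_pdivrMr// mulrAC ltr_pdivlMr//.
by rewrite exprSr -natr1; lra.
Qed.

Lemma pgf5_lt m n (s : R) : (0 < m)%N -> (m < n)%N -> 0 <= s < 1 ->
  pgf5 m s < pgf5 n s.
Proof.
move=> m0 + s01; elim: n => // n IH; rewrite ltnS leq_eqVlt => /predU1P[<-|mn].
  exact: pgf5_ltS.
by rewrite (lt_trans (IH mn))// pgf5_ltS// (ltn_trans m0).
Qed.

Lemma pgf1_ge m (s : R) : (1 < m)%N -> 0 <= s <= 1 -> ((1 + s) / 2) ^+ 2 <= pgf1 m s.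
Proof.
move=> m1 /andP[s0]; rewrite le_eqVlt => /predU1P[->|s1].
  by rewrite /pgf1 subrr mul0r subr0 expr1n divff// expr1n.
have -> : ((1 + s) / 2) ^+ 2 = pgf1 2 s by rewrite /pgf1; congr (_ ^+ _); field.
have [->//|m2] := eqVneq m 2%N.
by rewrite ltW// pgf1_lt ?s0// ltn_neqAle eq_sym m2.
Qed.

Lemma critical_pgf1 m : (1 < m)%N -> critical_pgf (pmf1 R m) (pgf1 m).
Proof.
move=> m1; have m0 : (0 : R) < m%:R by rewrite ltr0n ltnW.
have im1 : (m%:R^-1 : R) <= 1 by rewrite invf_le1// ler1n ltnW.
have p0 k : 0 <= pmf1 R m k.
  by rewrite /pmf1 !mulr_ge0// exprn_ge0// ?invr_ge0 ?subr_ge0// ltW.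
split => //.
- move=> s /andP[s0 s1]; rewrite (nneseries_finite (N := m.+1)).
  + rewrite /pgf1 (_ : 1 - _ = (1 - m%:R^-1) + s / m%:R); last by ring.
    rewrite exprDn; congr EFin; apply: eq_bigr => i _.
    by rewrite /pmf1 -mulr_natl exprMn; ring.
  + by move=> k; rewrite mulr_ge0 ?exprn_ge0.
  + by move=> k mk; rewrite /pmf1 bin_small// !mul0r.
- by rewrite /pgf1 subrr mul0r subr0 expr1n.
- move=> s t t0 ts s1; rewrite /pgf1.
  have le1 (u : R) : u <= 1 -> 1 - (1 - u) / m%:R <= 1.
    by move=> u1; rewrite gerBl divr_ge0 ?subr_ge0// ltW.
  have mle : 1 - (1 - t) / m%:R <= 1 - (1 - s) / m%:R.
    by rewrite lerD2l lerN2 ler_wpM2r ?invr_ge0 ?(ltW m0)// lerD2l lerN2.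
  have t0' : 0 <= 1 - (1 - t) / m%:R.
    by rewrite subr_ge0 ler_pdivrMr// mul1r (@le_trans _ _ 1) ?gerBl// ler1n ltnW.
  have h := exprn_sub_le m t0' mle (le1 _ s1).
  apply: (le_trans h).
  by rewrite le_eqVlt; apply/orP; left; apply/eqP; field; rewrite gt_eqF.
- by move=> s; exact: pgf1_ge.
Qed.

Lemma critical_pgf2 : critical_pgf (pmf2 R) pgf2.
Proof.
split.
- by move=> k; rewrite /pmf2 divr_ge0// expR_ge0.
- move=> s /andP[s0 s1]; rewrite /pgf2 addrC expRD EFinM -(expR_eseries s).
  rewrite -nneseriesZl => [|k _]; last by rewrite lee_fin divr_ge0// exprn_ge0.
  by apply: eq_eseriesr => k _; rewrite -EFinM /pmf2 mulrAC mulrA.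
- by rewrite /pgf2 subrr expR0.
- move=> s t t0 ts s1; rewrite /pgf2.
  have e1 : expR (s - 1) <= 1 by rewrite -[leRHS]expR0 ler_expR subr_le0.
  have h : 1 + (t - s) <= expR (t - s) by exact: expR_ge1Dx.
  rewrite (_ : t - 1 = (s - 1) + (t - s)); last by ring.
  rewrite (expRD (s - 1)).
  (* The left-hand side is the increment [pgf2 s - pgf2 t]. *)
  have : expR (s - 1) * (1 - expR (t - s)) <= expR (s - 1) * (s - t).
    by rewrite ler_wpM2l ?expR_ge0//; lra.
  have : expR (s - 1) * (s - t) <= s - t by rewrite ler_piMl// subr_ge0.
  by lra.
- move=> s /andP[s0]; rewrite le_eqVlt => /predU1P[->|s1].
    by rewrite /pgf2 subrr expR0 divff// expr1n.
  by rewrite (@le_trans _ _ (pgf1 2 s)) ?pgf1_ge ?s0 ?(ltW s1)// ltW// pgf1_lt_pgf2// s0.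
Qed.

Lemma critical_pgf3 : critical_pgf (pmf3 R) pgf3.
Proof.
have p0 k : 0 <= pmf3 R k by rewrite /pmf3; case: ifP => // _; rewrite invr_ge0.
split => //.
- move=> s /andP[s0 s1]; rewrite (nneseries_finite (N := 3)).
  + by congr EFin; rewrite !big_ord_recr big_ord0 /= /pmf3 /pgf3 /=; field.
  + by move=> k; rewrite mulr_ge0 ?exprn_ge0.
  + by move=> [|[|[|k]]]//; rewrite /pmf3 /= mul0r.
- by rewrite /pgf3 expr1n; field.
- move=> s t t0 ts s1; rewrite /pgf3.
  have : 0 <= (s - t) * (2 - s - t) by rewrite mulr_ge0//; lra.
  by lra.
- by move=> s _; rewrite /pgf3; have := sqr_ge0 (1 - s); lra.
Qed.

Lemma critical_pgf4 : critical_pgf (pmf4 R) pgf4.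
Proof.
split.
- by move=> k; rewrite /pmf4 exprn_ge0// invr_ge0.
- move=> s /andP[s0 s1].
  apply: cvg_series_eseries; rewrite (_ : (fun k => _) = geometric (2^-1) (s / 2)).
    rewrite /pgf4 (_ : (2 - s)^-1 = 2^-1 * (1 - s / 2)^-1); last first.
      by field; rewrite !gt_eqF//; lra.
    by apply: cvg_geometric_series; rewrite ger0_norm ?divr_ge0//; lra.
  by apply/funext => k; rewrite /pmf4 /= exprS exprMn; ring.
- by rewrite /pgf4 (_ : 2 - 1 = 1) ?invr1//; ring.
- move=> s t t0 ts s1; rewrite /pgf4.
  have a0 : 0 < 2 - s by lra.
  have b0 : 0 < 2 - t by lra.
  rewrite (_ : (2 - s)^-1 - (2 - t)^-1 = (s - t) * ((2 - s) * (2 - t))^-1); last first.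
    by field; rewrite !gt_eqF.
  rewrite ler_piMr ?subr_ge0// invf_le1 ?mulr_gt0//.
  have : 0 <= (1 - s) * (1 - t) by rewrite mulr_ge0//; lra.
  by lra.
- move=> s /andP[s0 s1]; rewrite /pgf4 -[leRHS]div1r ler_pdivlMr; last by lra.
  have : 0 <= (s - 1) ^+ 2 * (s + 2) by rewrite mulr_ge0 ?sqr_ge0//; lra.
  by lra.
Qed.

Lemma critical_pgf5 m : (1 < m)%N -> critical_pgf (pmf5 R m) (pgf5 m).
Proof.
move=> m1; have m0 : (0 : R) < m%:R by rewrite ltr0n ltnW.
have im1 : (m%:R^-1 : R) <= 1 by rewrite invf_le1// ler1n ltnW.
have p0 k : 0 <= pmf5 R m k.
  rewrite /pmf5; case: ifP => _; first by rewrite subr_ge0.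
  by case: ifP => // _; rewrite invr_ge0 ltW.
split => //.
- move=> s /andP[s0 s1]; rewrite (nneseries_finite (N := m.+1)).
  + case: m m1 m0 {im1 p0} => // -[//|m] _ m0.
    rewrite big_ord_recl big_ord_recr/= big1 => [|[i im] _]; last first.
      by rewrite /pmf5/= /bump/= add1n eqSS ltn_eqF// mul0r.
    rewrite /pmf5/= /bump/= add1n eqxx /pgf5 expr0; congr EFin; ring.
  + by move=> k; rewrite mulr_ge0 ?exprn_ge0.
  + move=> k mk; rewrite /pmf5 !gtn_eqF ?mul0r//.
    exact: leq_ltn_trans mk.
- by rewrite /pgf5 expr1n subrr mul0r subr0.
- move=> s t t0 ts s1; rewrite /pgf5.
  rewrite (_ : _ - _ = (s ^+ m - t ^+ m) / m%:R); last by ring.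
  by rewrite ler_pdivrMr// mulrC exprn_sub_le.
- move=> s /andP[s0]; rewrite le_eqVlt => /predU1P[->|s1].
    by rewrite /pgf5 expr1n subrr mul0r subr0 divff// expr1n.
  (* [pgf5 2] exceeds the required bound by [((1 - s) / 2) ^ 2], and [pgf5] increases with [m]; this
     is why the lemma starts at [m = 2]. *)
  apply: (@le_trans _ _ (pgf5 2 s)).
    by rewrite /pgf5; have := sqr_ge0 (1 - s); lra.
  have [->//|m2] := eqVneq m 2%N.
  by rewrite ltW// pgf5_lt ?s0// ltn_neqAle eq_sym m2.
Qed.

(** The relation is abstract so that one pass along the chain serves negative powers, positive
    powers and the logarithm, the last two with the order reversed. *)
Lemma offspring_chain (rel : (nat -> R) -> (nat -> R) -> Prop) :
  (forall p1 p2 Phi1 Phi2, critical_pgf p1 Phi1 -> critical_pgf p2 Phi2 ->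
    (forall s : R, 0 < s < 1 -> Phi1 s < Phi2 s) -> rel p1 p2) ->
  (forall m n : nat, (2 <= m)%N -> (m < n)%N -> rel (pmf1 R m) (pmf1 R n)) /\
  (forall m n : nat, (3 <= m)%N -> (m < n)%N -> rel (pmf5 R m) (pmf5 R n)) /\
  (forall m : nat, (2 <= m)%N -> rel (pmf1 R m) (pmf2 R)) /\
  rel (pmf2 R) (pmf3 R) /\ rel (pmf3 R) (pmf4 R) /\
  rel (pmf4 R) (pmf5 R 3).
Proof.
move=> lt_rel.
have half (s : R) : 0 < s < 1 -> 0 <= s < 1 by move=> /andP[/ltW -> ->].
split=> [m n m2 mn|].
  apply: (lt_rel _ _ (pgf1 m) (pgf1 n)) => [||s /half].
  - exact: critical_pgf1.
  - by apply: critical_pgf1; exact: ltn_trans mn.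
  - exact: pgf1_lt.
split=> [m n m3 mn|].
  apply: (lt_rel _ _ (pgf5 m) (pgf5 n)) => [||s /half].
  - by apply: critical_pgf5; exact: ltnW.
  - by apply: critical_pgf5; exact: ltn_trans (ltnW m3) mn.
  - by apply: pgf5_lt => //; exact: leq_trans m3.
split=> [m m2|].
  apply: (lt_rel _ _ (pgf1 m) pgf2) => [||s /half].
  - exact: critical_pgf1.
  - exact: critical_pgf2.
  - exact: pgf1_lt_pgf2.
split.
  apply: lt_rel critical_pgf2 critical_pgf3 _ => s /half; exact: pgf2_lt_pgf3.
split; first by apply: lt_rel critical_pgf3 critical_pgf4 _; exact: pgf3_lt_pgf4.
apply: lt_rel critical_pgf4 (critical_pgf5 (isT : 1 < 3)%N) _ => s /half.
exact: pgf4_lt_pgf5.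
Qed.

End offspring_laws.

Unset Implicit Arguments.
Local Open Scope ereal_scope.

Theorem theorem6p12 (R : realType) :
  (* (a) alpha < 0 *)
  (forall alpha : R, (alpha < 0)%R ->
     (forall m n : nat, (2 <= m)%N -> (m < n)%N ->
        gw_mu (pmf1 R m) alpha < gw_mu (pmf1 R n) alpha) /\
     (forall m n : nat, (3 <= m)%N -> (m < n)%N ->
        gw_mu (pmf5 R m) alpha < gw_mu (pmf5 R n) alpha) /\
     (forall m : nat, (2 <= m)%N -> gw_mu (pmf1 R m) alpha < gw_mu (pmf2 R) alpha) /\
     gw_mu (pmf2 R) alpha < gw_mu (pmf3 R) alpha /\
     gw_mu (pmf3 R) alpha < gw_mu (pmf4 R) alpha /\
     gw_mu (pmf4 R) alpha < gw_mu (pmf5 R 3) alpha) /\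
  (* (b) 0 < alpha < 1/2 : reversed *)
  (forall alpha : R, (0 < alpha)%R -> (alpha < 2^-1)%R ->
     (forall m n : nat, (2 <= m)%N -> (m < n)%N ->
        gw_mu (pmf1 R n) alpha < gw_mu (pmf1 R m) alpha) /\
     (forall m n : nat, (3 <= m)%N -> (m < n)%N ->
        gw_mu (pmf5 R n) alpha < gw_mu (pmf5 R m) alpha) /\
     (forall m : nat, (2 <= m)%N -> gw_mu (pmf2 R) alpha < gw_mu (pmf1 R m) alpha) /\
     gw_mu (pmf3 R) alpha < gw_mu (pmf2 R) alpha /\
     gw_mu (pmf4 R) alpha < gw_mu (pmf3 R) alpha /\
     gw_mu (pmf5 R 3) alpha < gw_mu (pmf4 R) alpha) /\
  (* (b) for mu' = E log|T| : reversed *)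
  ((forall m n : nat, (2 <= m)%N -> (m < n)%N ->
      gw_mu' (pmf1 R n) < gw_mu' (pmf1 R m)) /\
   (forall m n : nat, (3 <= m)%N -> (m < n)%N ->
      gw_mu' (pmf5 R n) < gw_mu' (pmf5 R m)) /\
   (forall m : nat, (2 <= m)%N -> gw_mu' (pmf2 R) < gw_mu' (pmf1 R m)) /\
   gw_mu' (pmf3 R) < gw_mu' (pmf2 R) /\
   gw_mu' (pmf4 R) < gw_mu' (pmf3 R) /\
   gw_mu' (pmf5 R 3) < gw_mu' (pmf4 R)).
Proof.
split=> [alpha a0|].
  apply: (offspring_chain (rel := fun p q => gw_mu p alpha < gw_mu q alpha)).
  by move=> p1 p2 Phi1 Phi2 H1 H2 lt12; exact: gw_mu_lt_neg H1 H2 lt12 _ a0.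
split=> [alpha a0 a1|].
  apply: (offspring_chain (rel := fun p q => gw_mu q alpha < gw_mu p alpha)).
  by move=> p1 p2 Phi1 Phi2 H1 H2 lt12; exact: gw_mu_lt_pos H1 H2 lt12 _ a0 a1.
apply: (offspring_chain (rel := fun p q => gw_mu' q < gw_mu' p)).
by move=> p1 p2 Phi1 Phi2; exact: gw_mu'_lt.
Qed.
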